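(* Let $\Lambda=(\xi_2,\ldots,\xi_p,\eta)\in \mathrm{Z}(\mathcal{D})$. Substitute $\xi_i'=\xi_1'\xi_i$ $(i=2,\ldots,p)$, $\eta'=\xi_1'\eta$, with $\xi_1'\neq 0$, into the system $C'$, and regard the result (still denoted $C'$) as a differential polynomial system in $\mathcal{K}_{\mathbf{z}}[\Lambda,\xi_1']$. If, for the given $\Lambda$, this system has no zero points, i.e. $\mathrm{Z}(C')=\emptyset$ (there is no $\xi_1'\neq 0$ for which $(\Lambda,\xi_1')$ annihilates all elements of $C'$), then the operator $$\mathcal{X}=\partial_{x_1}+\sum_{i=2}^p\xi_i\,\partial_{x_i}+\eta\,\partial_u$$ is a nontrivial nonclassical symmetry of the PDE $\mathrm{F}[u]=0$.
   Context: **PDE and symmetries.** Let $\mathrm{F}[u]=\mathrm{F}(\mathbf{x},\partial^k u)=0$ be a scalar $k$th order PDE with independent variables $\mathbf{x}=(x_1,\ldots,x_p)$ and one dependent variable $u$, where $\partial^k u$ denotes all derivatives of $u$ of order $\le k$ and $\mathrm{F}$ is a polynomial in its arguments. Put $\mathbf{z}=(x_1,\ldots,x_p,u)$. A classical symmetry is an operator $\mathcal{X}'=\sum_{i=1}^p\xi_i'\partial_{x_i}+\eta'\partial_u$, with coefficients functions of $\mathbf{z}$, whose prolongation satisfies $\mathrm{Pr}\mathcal{X}'(\mathrm{F})=0$ whenever $\mathrm{F}=0$. This condition is equivalent to an overdetermined system $\mathcal{D}'=0$ of homogeneous linear PDEs (the determining equations) for $\Lambda'=(\xi_1',\ldots,\xi_p',\eta')$.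 A nonclassical symmetry is an operator $\mathcal{X}=\sum_{i=1}^p\xi_i\partial_{x_i}+\eta\partial_u$, with coefficients functions of $\mathbf{z}$, such that $\mathrm{Pr}\mathcal{X}(\mathrm{F})=0$ holds on the manifold defined by $\mathrm{F}=0$ and the differential consequences of the invariant surface equation $\sum_{i=1}^p\xi_iu_{x_i}-\eta=0$. Throughout, $\xi_1\ne0$ is assumed and normalized to $\xi_1=1$; the condition is then equivalent to a (generally nonlinear) system $\mathcal{D}=0$ of PDEs for $\Lambda=(\xi_2,\ldots,\xi_p,\eta)$. Two operators $\mathcal{X}',\mathcal{X}$ are equivalent if $\mathcal{X}'=\lambda(\mathbf{z})\mathcal{X}$ for a nonzero function $\lambda$. A nonclassical symmetry is nontrivial if it is not equivalent to any classical symmetry. **Differential polynomials.** $\mathcal{K}_{\mathbf{z}}$ is a field of characteristic zero of differential functions of $\mathbf{z}$, and $\mathcal{K}_{\mathbf{z}}[\zeta]$ is the ring of differential polynomials over it in the indeterminates $\zeta$ (differentiation with respect to the components of $\mathbf{z}$). The sets of left-hand sides of the determining equations are $\mathcal{D}'\subset\mathcal{K}_{\mathbf{z}}[\Lambda']$ and $\mathcal{D}\subset\mathcal{K}_{\mathbf{z}}[\Lambda]$. $\mathrm{Z}(\cdot)$ denotes the set of zeros of a differential polynomial system over some extension of $\mathcal{K}_{\mathbf{z}}$, i.e. the solution set of the corresponding system of equations. Given a rank (ordering) $\prec$ of differential polynomials, the initial of a differential polynomial is the coefficient of (the highest power of) its leading derivative, and its separant is its partial derivative with respect to the leading derivative.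 A differential ascending chain is a finite set $\mathcal{A}_1\prec\cdots\prec\mathcal{A}_s$ with each $\mathcal{A}_j$ reduced with respect to $\mathcal{A}_1,\ldots,\mathcal{A}_{j-1}$. An IS product of a chain is a product of initials and separants of its elements. **The chain $C'$.** Fix a rank $\prec$ on $\mathcal{K}_{\mathbf{z}}[\Lambda']$ with $\xi_1'$ highest among the indeterminates. $C'\subset \mathcal{K}_{\mathbf{z}}[\Lambda']$ is an ascending chain form of $\mathcal{D}'$ obtained by Wu's algorithm under this rank; its elements are linear. Standing assumption: the initials of the elements of $C'$ are not zero, $\mathrm{IS}(C')\not\equiv0$; under this assumption $\mathrm{Z}(C')=\mathrm{Z}(\mathcal{D}')$, so $\mathrm{Z}(C')$ represents the classical symmetries of the PDE. *)

(* Defs.v *)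
From HB Require Import structures.
From mathcomp Require Import all_boot all_order all_algebra finmap.
From mathcomp Require Import monalg.

Set Implicit Arguments.
Unset Strict Implicit.
Unset Printing Implicit Defensive.

Import GRing.Theory.
Local Open Scope ring_scope.

(* Multi-indices are the elements of [{cmonom 'I_n}].  The monoid law of
   [cmonom] is written multiplicatively, so [1%M] is the zero multi-index and
   [(a * U_(i))%M] is a + e_i; [divcm] is truncated componentwise
   subtraction. *)

Local Notation "1" := (@mone _) : monom_scope.
Local Notation "x * y" := (mmul x y) : monom_scope.
Local Notation "'U_(' i )" := (ucm i) : monom_scope.

(* Polynomials over R in the variables I, possibly infinitely many. *)
Definition poly_in (R : comNzRingType) (I : choiceType) : Type :=
  {malg R[{cmonom I}]}.

HB.instance Definition _ (R : comNzRingType) (I : choiceType) :=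
  GRing.ComNzRing.copy (poly_in R I) {malg R[{cmonom I}]}.

Section Polynomials.
Variables (R : comNzRingType) (I : choiceType).
Implicit Types (g : poly_in R I) (v : I) (m : {cmonom I}).

Definition pvar v : poly_in R I := << U_(v)%M >>.

Definition pconst (c : R) : poly_in R I := c%:MP.

Definition vars g : {fset I} :=
  (\big[fsetU/fset0]_(m <- msupp g) finsupp m)%fset.

Definition vdeg v g : nat := \max_(m <- msupp g) m v.

(* The coefficient of v^d in g, a polynomial in the other variables. *)
Definition vcoef v (d : nat) g : poly_in R I :=
  \sum_(m <- msupp g | m v == d) << g@_m *g divcm m (expcmn U_(v)%M d) >>.

Definition pderiv v g : poly_in R I :=
  \sum_(m <- msupp g) << g@_m *+ m v *g divcm m U_(v)%M >>.

(* The derivation equal to d on the coefficients and sending v to w v. *)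
Definition derivation_ext (d : R -> poly_in R I)
    (w : I -> poly_in R I) g : poly_in R I :=
  mmap d (fun m => << m >>) g + \sum_(v <- vars g) pderiv v g * w v.

Definition peval (S : comNzRingType) (f : R -> S) (x : I -> S) g : S :=
  mmap f (fun m => \prod_(v <- finsupp m) x v ^+ m v) g.

End Polynomials.

(* D_0^(a_0) ... D_(n-1)^(a_(n-1)); only used for commuting D_i. *)
Definition iter_der (T : Type) (n : nat) (D : 'I_n -> T -> T)
    (a : {cmonom 'I_n}) (x : T) : T :=
  foldr (fun i y => iter (a i) (D i) y) x (enum 'I_n).

(* Fields of characteristic zero of functions of z = (z_0, ..., z_(n-1)),
   closed under the partial derivatives and containing the coordinates. *)
Record diffField (n : nat) := DiffField {
  dfield :> fieldType;
  der : 'I_n -> dfield -> dfield;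
  coord : 'I_n -> dfield;
  derD : forall i x y, der i (x + y) = der i x + der i y;
  derM : forall i x y, der i (x * y) = der i x * y + x * der i y;
  der_comm : forall i j x, der i (der j x) = der j (der i x);
  der_coord : forall i j, der i (coord j) = (i == j)%:R;
  dfield_char0 : [pchar dfield] =i pred0
}.

Record diffExt (n : nat) (K E : diffField n) := DiffExt {
  emb :> {rmorphism K -> E};
  emb_der : forall i x, emb (der i x) = der i (emb x);
  emb_coord : forall i, emb (coord K i) = coord E i
}.

Section DifferentialPolynomials.
Variables (n m : nat).

(* (j, a) is the derivative of order a of the j-th indeterminate. *)
Definition dvar : choiceType := ('I_m * {cmonom 'I_n})%type.

Definition dvarD (i : 'I_n) (v : dvar) : dvar := (v.1, (v.2 * U_(i))%M).

Definition dpoly (K : diffField n) := poly_in K dvar.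

Definition dindet (K : diffField n) (j : 'I_m) : dpoly K := pvar K (j, 1%M).

Definition dder (K : diffField n) (i : 'I_n) : dpoly K -> dpoly K :=
  derivation_ext (fun a : K => pconst dvar (der i a))
    (fun v => pvar K (dvarD i v)).

Definition deval (K E : diffField n) (phi : diffExt K E) (x : 'I_m -> E)
    (f : dpoly K) : E :=
  peval phi (fun v : dvar => iter_der (@der n E) v.2 (x v.1)) f.

Definition dzero (K E : diffField n) (phi : diffExt K E)
    (P : seq (dpoly K)) (x : 'I_m -> E) : Prop :=
  forall f, f \in P -> deval phi x f = 0.

Definition dlinear (K : diffField n) (f : dpoly K) : Prop :=
  forall mu, mu \in msupp f -> (mdeg mu <= 1)%N.

Definition dlinear_homogeneous (K : diffField n) (f : dpoly K) : Prop :=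
  forall mu, mu \in msupp f -> mdeg mu = 1%N.

Definition ranking (le : rel dvar) : Prop :=
  [/\ total le, antisymmetric le, transitive le,
      forall i v, le v (dvarD i v)
    & forall i v w, le v w -> le (dvarD i v) (dvarD i w)].

End DifferentialPolynomials.

(* G gives the values of the indeterminates. *)
Definition dsubst (n m m' : nat) (K : diffField n) (G : 'I_m -> dpoly m' K)
    (f : dpoly m K) : dpoly m' K :=
  peval (pconst _)
    (fun v : dvar n m => iter_der (@dder n m' K) v.2 (G v.1)) f.

Section WuAlgorithm.
Variables (n m : nat) (K : diffField n) (le : rel (dvar n m)).
Implicit Types (f g c r : dpoly m K) (A B C P : seq (dpoly m K)).

Definition leader f : option (dvar n m) :=
  ohead (sort (fun v w => le w v) (vars f)).

Definition initial f : dpoly m K :=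
  if leader f is Some v then vcoef v (vdeg v f) f else f.

Definition separant f : dpoly m K :=
  if leader f is Some v then pderiv v f else 0.

Definition dpoly_lt f g : bool :=
  match leader f, leader g with
  | None, Some _ => true
  | Some v, Some w =>
      ((v != w) && le v w) || ((v == w) && (vdeg v f < vdeg v g)%N)
  | _, None => false
  end.

Definition proper_derivative (v w : dvar n m) : bool :=
  [&& v != w, v.1 == w.1 & [forall i, (v.2 i <= w.2 i)%N]].

(* f is reduced with respect to g. *)
Definition reduced f g : bool :=
  if leader g is Some v then
    all (fun w => ~~ proper_derivative v w) (vars f) && (vdeg v f < vdeg v g)%N
  else f == 0.

Definition ascending_chain A : bool :=
  all (fun f => leader f != None) A &&
  pairwise (fun f g => dpoly_lt f g && reduced g f) A.

(* Among chains with a common initial part, the longer one is lower. *)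
Fixpoint chain_lt A B : bool :=
  match A, B with
  | [::], _ => false
  | _ :: _, [::] => true
  | f :: A', g :: B' =>
      dpoly_lt f g || (~~ dpoly_lt g f && chain_lt A' B')
  end.

Definition basic_set P B : Prop :=
  [/\ ascending_chain B, {subset B <= P}
    & forall A, ascending_chain A -> {subset A <= P} -> ~~ chain_lt A B].

(* One pseudo-division of f by a derivative q of c.  For a proper derivative,
   the leader v occurs linearly in q and initial q is the separant of c. *)
Definition pseudo_step c f g : Prop :=
  exists (a : {cmonom 'I_n}) (v : dvar n m),
    let q := iter_der (@dder n m K) a c in
    [/\ leader q = Some v, v \in vars f, (vdeg v q <= vdeg v f)%N
      & g = initial q * f
            - vcoef v (vdeg v f) f * pvar K v ^+ (vdeg v f - vdeg v q) * q].

Inductive pseudo_steps C f : dpoly m K -> Prop :=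
| PseudoRefl : pseudo_steps C f f
| PseudoTrans c g h : c \in C -> pseudo_steps C f g -> pseudo_step c g h ->
    pseudo_steps C f h.

(* r is a differential pseudo-remainder of f with respect to C. *)
Definition pseudo_rem C f r : Prop :=
  pseudo_steps C f r /\ all (reduced r) C.

(* Cross-differentiation of f and g to the least common derivative of their
   leaders; [divcm b a] is the multi-index lcm(a, b) - a. *)
Definition integrability_pair f g : dpoly m K :=
  match leader f, leader g with
  | Some (i, a), Some (j, b) =>
      if i == j then
        separant g * iter_der (@dder n m K) (divcm b a) f
        - separant f * iter_der (@dder n m K) (divcm a b) g
      else 0
  | _, _ => 0
  end.

Definition to_reduce P B : seq (dpoly m K) :=
  [seq f <- P | f \notin B] ++ [seq integrability_pair f g | f <- B, g <- B].

(* wu P C: from the finite system P, Wu's algorithm may end with the chain C.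
   The function rem collects the pseudo-remainders computed in one round. *)
Inductive wu P : seq (dpoly m K) -> Prop :=
| WuStop B :
    basic_set P B ->
    (forall f, f \in to_reduce P B -> pseudo_rem B f 0) ->
    wu P B
| WuNext B (rem : dpoly m K -> dpoly m K) C :
    basic_set P B ->
    (forall f, f \in to_reduce P B -> pseudo_rem B f (rem f)) ->
    has (fun f => rem f != 0) (to_reduce P B) ->
    wu (P ++ [seq r <- map rem (to_reduce P B) | r != 0]) C ->
    wu P C.

Definition IS_product C J : Prop :=
  exists2 s : seq (dpoly m K),
    {subset s <= map initial C ++ map separant C} & J = \prod_(f <- s) f.

End WuAlgorithm.

(* q independent variables x_0, ..., x_(q-1) and one dependent variable u;
   z = (x_0, ..., x_(q-1), u).  An operator is the tuple of its q + 1
   coefficients, in the same order. *)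

Definition xidx (q : nat) (i : 'I_q) : 'I_q.+1 := widen_ord (leqnSn q) i.
Definition uidx (q : nat) : 'I_q.+1 := ord_max.

(* Variables: inl i is x_i, inr a is the derivative u_a (u itself for a = 0). *)
Definition pde (q : nat) (K : diffField q.+1) :=
  poly_in K ('I_q + {cmonom 'I_q})%type.

Definition pde_of_order (q : nat) (K : diffField q.+1) (k : nat) (F : pde K)
    : Prop :=
  [/\ (0 < k)%N,
      forall mu i, der i F@_mu = 0,
      forall a, inr a \in vars F -> (mdeg a <= k)%N
    & exists2 a, inr a \in vars F & mdeg a = k].

Section Symmetries.
Variables (q : nat) (K E : diffField q.+1) (phi : diffExt K E).
Implicit Types (X : 'I_q.+1 -> E) (a : {cmonom 'I_q}) (F : pde K).

(* Polynomials in the u_a, a != 0, over functions of z; as u is a coordinate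
   of z, it is a coefficient and not a variable. *)
Definition jpoly := poly_in E {cmonom 'I_q}.

Definition jconst (f : E) : jpoly := pconst _ f.

Definition jvar a : jpoly :=
  if a == 1%M then jconst (coord E (uidx q)) else pvar E a.

Definition total_der (i : 'I_q) : jpoly -> jpoly :=
  derivation_ext
    (fun f : E =>
       jconst (der (xidx i) f) + jconst (der (uidx q) f) * jvar U_(i)%M)
    (fun a => jvar (a * U_(i))%M).

Definition jet_of (F : pde K) : jpoly :=
  peval (fun c : K => jconst (phi c))
    (fun v => match v with
              | inl i => jconst (coord E (xidx i))
              | inr a => jvar a
              end) F.

(* eta - sum_i xi_i u_(x_i) *)
Definition characteristic X : jpoly :=
  jconst (X (uidx q)) - \sum_(i < q) jconst (X (xidx i)) * jvar U_(i)%M.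

(* The coefficient of d/du_a in the prolongation of X; it is eta for a = 0. *)
Definition prolongation_coef X a : jpoly :=
  iter_der total_der a (characteristic X)
  + \sum_(i < q) jconst (X (xidx i)) * jvar (a * U_(i))%M.

Definition prolongation X F : jpoly :=
  \sum_(v <- vars F)
    (match v with
     | inl i => jconst (X (xidx i))
     | inr a => prolongation_coef X a
     end) * jet_of (pderiv v F).

(* g vanishes at every point of jet space satisfying the equations in S; a
   point over generic z assigns to the u_a values in a field containing E. *)
Definition vanishes_on (S : jpoly -> Prop) (g : jpoly) : Prop :=
  forall (L : fieldType) (f : {rmorphism E -> L}) (y : {cmonom 'I_q} -> L),
    (forall h, S h -> peval f y h = 0) -> peval f y g = 0.

Definition classical_symmetry F X : Prop :=
  vanishes_on (fun h => h = jet_of F) (prolongation X F).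

Definition nonclassical_symmetry F X : Prop :=
  vanishes_on
    (fun h => h = jet_of F \/
              exists a, h = iter_der total_der a (characteristic X))
    (prolongation X F).

Definition equivalent_operators (X' X : 'I_q.+1 -> E) : Prop :=
  exists2 lambda : E, lambda != 0 & forall i, X' i = lambda * X i.

Definition nontrivial_nonclassical_symmetry F X : Prop :=
  nonclassical_symmetry F X /\
  ~ exists2 X', classical_symmetry F X' & equivalent_operators X' X.

End Symmetries.

(* (w, Lam_0, ..., Lam_(q-1)) *)
Definition adjoin (q : nat) (T : Type) (w : T) (Lam : 'I_q -> T) (i : 'I_q.+1)
    : T :=
  if unlift ord0 i is Some j then Lam j else w.

Definition classical_determining_system (q : nat) (K E : diffField q.+1)
    (phi : diffExt K E) (F : pde K) (D' : seq (dpoly q.+1 K)) : Prop :=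
  (forall d, d \in D' -> dlinear_homogeneous d) /\
  forall X' : 'I_q.+1 -> E, classical_symmetry phi F X' <-> dzero phi D' X'.

(* The indeterminates are the coefficients after the first one, which is 1. *)
Definition nonclassical_determining_system (q : nat) (K E : diffField q.+1)
    (phi : diffExt K E) (F : pde K) (D : seq (dpoly q K)) : Prop :=
  forall Lam : 'I_q -> E,
    nonclassical_symmetry phi F (adjoin 1 Lam) <-> dzero phi D Lam.

(* xi_1' := xi_1' and Lam_j' := xi_1' Lam_j; indeterminate 0 is xi_1' on both
   sides. *)
Definition substitute_xi1 (q : nat) (K : diffField q.+1)
    (f : dpoly q.+1 K) : dpoly q.+1 K :=
  dsubst (adjoin (dindet K ord0)
            (fun j : 'I_q => dindet K ord0 * dindet K (lift ord0 j))) f.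

(* xi_1' is compared with the other indeterminates themselves, so orderly and
   elimination rankings are both allowed. *)
Definition xi1_highest (n q : nat) (le : rel (dvar n q.+1)) : Prop :=
  forall j : 'I_q.+1, le (j, 1%M) (ord0, 1%M).

(* Main.v *)
From HB Require Import structures.
Require Import Defs.
From mathcomp Require Import all_boot all_order all_algebra finmap.
From mathcomp Require Import monalg.

Set Implicit Arguments.
Unset Strict Implicit.
Unset Printing Implicit Defensive.
Import GRing.Theory.
Local Open Scope ring_scope.

(** Write Z(.) for the zeros in E.  That the operator (1, Lam) is a nonclassical
    symmetry is what Lam \in Z(D) means.  If it were trivial, some classical
    symmetry X' would equal lambda (1, Lam) with lambda nonzero, and X' would
    be in Z(D').  Every differential polynomial produced by Wu's algorithm is
    a combination of derivatives of elements of D', so X' is also in Z(C')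
    ([wu_zero]).  Substituting xi_1' and xi_1' Lam_j for the indeterminates and
    then evaluating at xi_1' = lambda is the same as evaluating at
    lambda (1, Lam) = X' ([deval_substitute_xi1]); hence lambda is a solution
    xi_1' of the substituted system, which is assumed to have none.

    Both lemmas rest on one fact: evaluation of differential polynomials is a
    morphism of differential rings.  It is a ring morphism as the evaluation of
    ordinary polynomials in the derivatives of the indeterminates, and it
    commutes with the derivations ([deval_der]) by the chain rule
    ([peval_derivation_ext]), since the derivative i of the value of the
    variable (j, a) is the value of the variable (j, a + e_i)
    ([iter_der_step]). *)

(** * Evaluation of polynomials and derivations *)

Definition monom_eval (S : comNzRingType) (I : choiceType) (x : I -> S)
    (m : {cmonom I}) : S :=
  \prod_(v <- finsupp m) x v ^+ m v.

Lemma monom_evalEw (S : comNzRingType) (I : choiceType) (x : I -> S)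
    (m : {cmonom I}) (d : {fset I}) :
  (finsupp m `<=` d)%fset ->
  monom_eval x m = \prod_(v <- d) x v ^+ m v.
Proof.
move=> sub_md; rewrite /monom_eval (big_fset_incl _ sub_md) //= => v _.
by rewrite -cmE_eq0 => /eqP->; rewrite expr0.
Qed.

Lemma monom_eval_mmorphism (S : comNzRingType) (I : choiceType) (x : I -> S) :
  mmorphism (monom_eval x).
Proof.
split=> [m1 m2|]; last by rewrite /monom_eval mdom1 big_seq_fset0.
have sub12 : (finsupp (mmul m1 m2) `<=` finsupp m1 `|` finsupp m2)%fset.
  by rewrite mdomD.
rewrite (monom_evalEw _ sub12) (monom_evalEw x (fsubsetUl _ (finsupp m2))).
rewrite (monom_evalEw x (fsubsetUr (finsupp m1) _)) -big_split /=.
by apply: eq_bigr => v _; rewrite cmM exprD.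
Qed.

HB.instance Definition _ (S : comNzRingType) (I : choiceType) (x : I -> S) :=
  isMultiplicative.Build {cmonom I} S (monom_eval x)
    (monom_eval_mmorphism x).

(** Expressed through [mmap] of a monoid morphism, [peval] inherits the ring
    morphism structure of the evaluation of monoid algebras. *)
HB.instance Definition _ (R S : comNzRingType) (I : choiceType)
    (f : {rmorphism R -> S}) (x : I -> S) :=
  GRing.RMorphism.copy (@peval R I S f x : poly_in R I -> S)
    (mmap f (monom_eval x) : {malg R[{cmonom I}]} -> S).

Section PevalTheory.
Variables (R S : comNzRingType) (I : choiceType).
Variables (f : {rmorphism R -> S}) (x : I -> S).

Lemma peval_monomial (c : R) (m : {cmonom I}) :
  peval f x << c *g m >> = f c * monom_eval x m.
Proof. exact: mmapU. Qed.

Lemma peval_const (c : R) : peval f x (pconst I c) = f c.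
Proof. by rewrite [LHS]peval_monomial mmorph1 mulr1. Qed.

Lemma peval_var (v : I) : peval f x (pvar R v) = x v.
Proof.
rewrite peval_monomial rmorph1 mul1r /monom_eval mdomU big_seq_fset1 cmUU.
exact: expr1.
Qed.

End PevalTheory.

Section DerivationTheory.
Variables (S : comNzRingType) (delta : S -> S).
Hypothesis deltaD : forall a b, delta (a + b) = delta a + delta b.
Hypothesis deltaM : forall a b, delta (a * b) = delta a * b + a * delta b.

Lemma derivation0 : delta 0 = 0.
Proof. by apply: (addrI (delta 0)); rewrite -deltaD !addr0. Qed.

Lemma derivation1 : delta 1 = 0.
Proof.
by apply: (addrI (delta 1)); rewrite addr0 -{3}[1]mulr1 deltaM mulr1 mul1r.
Qed.

Lemma derivation_sum (T : Type) (s : seq T) (F : T -> S) :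
  delta (\sum_(t <- s) F t) = \sum_(t <- s) delta (F t).
Proof. exact: (big_morph delta deltaD derivation0). Qed.

Lemma derivationX (a : S) (n : nat) :
  delta (a ^+ n) = a ^+ n.-1 *+ n * delta a.
Proof.
elim: n => [|n IHn]; first by rewrite expr0 mulr0n mul0r derivation1.
rewrite exprS deltaM IHn mulrA [delta a * _]mulrC -mulrDl; congr (_ * _) => /=.
case: n {IHn} => [|n] /=; first by rewrite mulr0n mulr0 addr0.
by rewrite mulrnAr -exprS -mulrS.
Qed.

Lemma derivation_prod (T : eqType) (s : seq T) (F : T -> S) : uniq s ->
  delta (\prod_(t <- s) F t)
  = \sum_(t <- s) delta (F t) * \prod_(w <- s | w != t) F w.
Proof.
elim: s => [_|t s IHs /= /andP[t_notin_s s_uniq]].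
  by rewrite !big_nil derivation1.
rewrite !big_cons eqxx /= deltaM IHs // big_distrr /=; congr (_ * _ + _).
  rewrite [LHS]big_seq [RHS]big_seq_cond; apply: eq_bigl => w.
  by case: eqVneq => [->|]; rewrite ?(negbTE t_notin_s) ?andbT.
rewrite big_seq [RHS]big_seq; apply: eq_bigr => w w_in_s.
rewrite big_cons ifT; first by rewrite mulrCA.
by apply: contraNneq t_notin_s => ->.
Qed.

(** The sum may range over any finite set d containing the support of m, so that
    the formulas for the monomials of one polynomial can be added over a common
    set of variables. *)
Lemma derivation_monom_eval (I : choiceType) (x : I -> S) (m : {cmonom I})
    (d : {fset I}) : (finsupp m `<=` d)%fset ->
  delta (monom_eval x m)
  = \sum_(v <- d) monom_eval x (divcm m (ucm v)) *+ m v * delta (x v).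
Proof.
move=> sub_md; rewrite (monom_evalEw _ sub_md) derivation_prod ?fset_uniq //.
rewrite big_seq [RHS]big_seq; apply: eq_bigr => v v_in_d.
rewrite derivationX mulrAC; congr (_ * _).
rewrite mulrnAl; congr (_ *+ _).
have sub_div : (finsupp (divcm m (ucm v)) `<=` d)%fset.
  apply: fsubset_trans sub_md; apply/fsubsetP => w.
  by rewrite -!cmE_neq0 divcmE; apply: contraNneq => ->.
rewrite (monom_evalEw _ sub_div) (bigD1_seq v) ?fset_uniq //=.
rewrite divcmE ucmE eqxx subn1.
congr (_ * _); apply: eq_bigr => w w_neq_v.
by rewrite divcmE ucmE eq_sym (negbTE w_neq_v) subn0.
Qed.

End DerivationTheory.

Lemma finsupp_sub_vars (R : comNzRingType) (I : choiceType)
    (g : poly_in R I) (m : {cmonom I}) :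
  m \in msupp g -> (finsupp m `<=` vars g)%fset.
Proof.
move=> m_in_g; apply/fsubsetP => v v_in_m.
by apply/bigfcupP; exists m; rewrite ?m_in_g.
Qed.

Section DerivationExtension.
Variables (R S : comNzRingType) (I : choiceType).
Variables (f : {rmorphism R -> S}) (x : I -> S).

Lemma peval_pderiv (v : I) (g : poly_in R I) :
  peval f x (pderiv v g)
  = \sum_(m <- msupp g)
      f g@_m * (monom_eval x (divcm m (ucm v)) *+ m v).
Proof.
rewrite rmorph_sum /=; apply: eq_bigr => m _.
by rewrite peval_monomial rmorphMn /= mulrnAl mulrnAr.
Qed.

(** The chain rule.  On a monomial c m, the Leibniz rule for delta gives
    delta(c) m, which is the part of [derivation_ext] coming from d, plus c
    times the derivative of m, whose terms grouped by variable instead of by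
    monomial are the part coming from w. *)
Lemma peval_derivation_ext (d : R -> poly_in R I) (w : I -> poly_in R I)
    (delta : S -> S) :
  (forall a b, delta (a + b) = delta a + delta b) ->
  (forall a b, delta (a * b) = delta a * b + a * delta b) ->
  (forall c, peval f x (d c) = delta (f c)) ->
  (forall v, peval f x (w v) = delta (x v)) ->
  forall g, peval f x (derivation_ext d w g) = delta (peval f x g).
Proof.
move=> deltaD deltaM evald evalw g; rewrite rmorphD /=.
have -> : delta (peval f x g)
    = \sum_(m <- msupp g) (delta (f g@_m) * monom_eval x m
                           + f g@_m * delta (monom_eval x m)).
  rewrite [X in delta X](_ : _
    = \sum_(m <- msupp g) f g@_m * monom_eval x m) //.
  by rewrite (derivation_sum deltaD); apply: eq_bigr => m _; rewrite deltaM.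
rewrite big_split /=; congr (_ + _).
  rewrite rmorph_sum /=; apply: eq_bigr => m _.
  by rewrite rmorphM /= evald peval_monomial rmorph1 mul1r.
transitivity (\sum_(m <- msupp g) \sum_(v <- vars g)
    f g@_m * (monom_eval x (divcm m (ucm v)) *+ m v * delta (x v))).
  rewrite rmorph_sum /= exchange_big /=; apply: eq_bigr => v _.
  rewrite rmorphM /= evalw peval_pderiv mulr_suml.
  by apply: eq_bigr => m _; rewrite mulrA.
rewrite big_seq [RHS]big_seq; apply: eq_bigr => m m_in_g.
rewrite (derivation_monom_eval deltaM x (finsupp_sub_vars m_in_g)).
by rewrite mulr_sumr.
Qed.

End DerivationExtension.

(** * Zeros of differential polynomials *)

Section IteratedDerivations.
Variables (T : Type) (n : nat).

Lemma iter_der1 (D : 'I_n -> T -> T) (y : T) : iter_der D mone y = y.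
Proof.
by rewrite /iter_der; elim: (enum _) => //= i s ->; rewrite cm1.
Qed.

(** [iter_der] applies the D_j in the order of the indices; commutation is what
    lets the additional D_i move from its place in that order to the front. *)
Lemma iter_der_step (D : 'I_n -> T -> T) (i : 'I_n) (a : {cmonom 'I_n})
    (y : T) :
  (forall j k z, D j (D k z) = D k (D j z)) ->
  iter_der D (mmul a (ucm i)) y = D i (iter_der D a y).
Proof.
move=> DC.
have iterC j b z : D i (iter b (D j) z) = iter b (D j) (D i z).
  by elim: b => //= b <-; rewrite DC.
have gen s : foldr (fun k z => iter (mmul a (ucm i) k) (D k) z) y s
    = iter (count_mem i s) (D i) (foldr (fun k z => iter (a k) (D k) z) y s).
  elim: s => //= k s ->.
  have iter_iterC c z :
      iter (a k) (D k) (iter c (D i) z) = iter c (D i) (iter (a k) (D k) z).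
    by elim: c => //= c <-; exact/esym/iterC.
  (* Only the block of index i grows by one step; the others commute with
     the D i in front of the inner fold. *)
  rewrite cmM cmU eq_sym; case: eqVneq => [ki|_].
    by rewrite addn1 iterS iter_iterC ki.
  by rewrite addn0 add0n iter_iterC.
by rewrite /iter_der gen count_uniq_mem ?enum_uniq // mem_enum.
Qed.

End IteratedDerivations.

Lemma iter_der_morph (T U : Type) (n : nat) (h : T -> U) (D : 'I_n -> T -> T)
    (D' : 'I_n -> U -> U) :
  (forall i y, h (D i y) = D' i (h y)) ->
  forall a y, h (iter_der D a y) = iter_der D' a (h y).
Proof.
move=> hD a y; rewrite /iter_der; elim: (enum _) => //= i s <-.
by elim: (a i) => //= b <-; rewrite hD.
Qed.

HB.instance Definition _ (n m : nat) (K E : diffField n) (phi : diffExt K E)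
    (x : 'I_m -> E) :=
  GRing.RMorphism.copy (deval phi x : poly_in K (dvar n m) -> E)
    (peval phi (fun v : dvar n m => iter_der (@der n E) v.2 (x v.1))).

Section DifferentialEvaluation.
Variables (n : nat) (K E : diffField n) (phi : diffExt K E).

Lemma devalB m (x : 'I_m -> E) (f g : dpoly m K) :
  deval phi x (f - g) = deval phi x f - deval phi x g.
Proof. exact: rmorphB. Qed.

Lemma devalM m (x : 'I_m -> E) (f g : dpoly m K) :
  deval phi x (f * g) = deval phi x f * deval phi x g.
Proof. exact: rmorphM. Qed.

Lemma deval_indet m (x : 'I_m -> E) (j : 'I_m) :
  deval phi x (dindet K j) = x j.
Proof. by rewrite [LHS]peval_var iter_der1. Qed.

Lemma deval_der m (x : 'I_m -> E) (i : 'I_n) (f : dpoly m K) :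
  deval phi x (dder i f) = der i (deval phi x f).
Proof.
apply: peval_derivation_ext => [||c|v]; [exact: derD|exact: derM| |].
  by rewrite peval_const emb_der.
by rewrite peval_var iter_der_step //; exact: der_comm.
Qed.

Lemma deval_iter_der m (x : 'I_m -> E) (a : {cmonom 'I_n}) (f : dpoly m K) :
  deval phi x (iter_der (@dder n m K) a f)
  = iter_der (@der n E) a (deval phi x f).
Proof. by apply: iter_der_morph => i g; exact: deval_der. Qed.

Lemma iter_der_der0 (a : {cmonom 'I_n}) : iter_der (@der n E) a 0 = 0.
Proof.
rewrite /iter_der; elim: (enum _) => //= i s ->.
by elim: (a i) => //= b ->; exact: derivation0 (@derD n E i).
Qed.

Lemma eq_deval m (x y : 'I_m -> E) (f : dpoly m K) :
  x =1 y -> deval phi x f = deval phi y f.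
Proof.
move=> xy; apply: eq_bigr => mu _; congr (_ * _).
by apply: eq_bigr => v _; rewrite xy.
Qed.

(** Holds because evaluation commutes with the iterated derivations through
    which [dsubst] replaces the derivatives of the indeterminates. *)
Lemma deval_subst m m' (x : 'I_m' -> E) (G : 'I_m -> dpoly m' K)
    (f : dpoly m K) :
  deval phi x (dsubst G f) = deval phi (fun j => deval phi x (G j)) f.
Proof.
rewrite rmorph_sum /=; apply: eq_bigr => mu _.
rewrite rmorphM /= [X in X * _]peval_const rmorph_prod /=; congr (_ * _).
by apply: eq_bigr => v _; rewrite rmorphXn /= deval_iter_der.
Qed.

End DifferentialEvaluation.

(** * Wu's algorithm keeps all zeros *)

Section WuZeros.
Variables (n m : nat) (K E : diffField n) (phi : diffExt K E).
Variables (le : rel (dvar n m)) (x : 'I_m -> E).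
Implicit Types (f g : dpoly m K) (B C P : seq (dpoly m K)).

Lemma dzero_sub B P : {subset B <= P} -> dzero phi P x -> dzero phi B x.
Proof. by move=> sBP Px f /sBP/Px. Qed.

(** The result of a pseudo-division step is a combination of f and of a
    derivative of c, and at x all derivatives of c vanish along with c. *)
Lemma pseudo_step_zero c f g : pseudo_step le c f g ->
  deval phi x c = 0 -> deval phi x f = 0 -> deval phi x g = 0.
Proof.
case=> a [v [_ _ _ ->]] cx fx.
by rewrite devalB [X in X - _]devalM [X in _ - X]devalM deval_iter_der
  cx fx iter_der_der0 !mulr0 subrr.
Qed.

Lemma pseudo_steps_zero C f g : pseudo_steps le C f g ->
  dzero phi C x -> deval phi x f = 0 -> deval phi x g = 0.
Proof.
move=> steps Cx fx; elim: steps => // c g' h cC _ g'x step.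
exact: pseudo_step_zero step (Cx c cC) g'x.
Qed.

Lemma integrability_pair_zero f g :
  deval phi x f = 0 -> deval phi x g = 0 ->
  deval phi x (integrability_pair le f g) = 0.
Proof.
move=> fx gx; rewrite /integrability_pair.
case: (leader le f) => [[i a]|]; last exact: rmorph0.
case: (leader le g) => [[j b]|]; last exact: rmorph0.
case: (i == j); last exact: rmorph0.
rewrite devalB [X in X - _]devalM [X in _ - X]devalM !deval_iter_der fx gx.
rewrite [X in _ * X - _]iter_der_der0 [X in _ - _ * X]iter_der_der0.
by rewrite [X in X - _]mulr0 mulr0 subrr.
Qed.

Lemma to_reduce_zero P B : {subset B <= P} ->
  dzero phi P x -> dzero phi (to_reduce le P B) x.
Proof.
move=> sBP Px f; rewrite mem_cat => /orP[|/allpairsP[[g h] /= [gB hB ->]]].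
  by rewrite mem_filter => /andP[_ /Px].
by apply: integrability_pair_zero; apply: Px; exact: sBP.
Qed.

(** By induction on the rounds: a basic set is a part of the current system, and
    the remainders adjoined to the system vanish wherever the system does. *)
Lemma wu_zero P C : wu le P C -> dzero phi P x -> dzero phi C x.
Proof.
elim=> {P C} [P B [_ sBP _] _|P B rem C [_ sBP _] remP _ _ IH] Px.
  exact: dzero_sub sBP Px.
have Bx := dzero_sub sBP Px.
apply: IH => r; rewrite mem_cat => /orP[/Px //|].
rewrite mem_filter => /andP[_ /mapP[f fR ->]].
exact: pseudo_steps_zero (remP f fR).1 Bx (to_reduce_zero sBP Px fR).
Qed.

End WuZeros.

(** * Operators proportional to a classical symmetry *)

Lemma adjoin_ord0 (q : nat) (T : Type) (w : T) (Lam : 'I_q -> T) :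
  adjoin w Lam ord0 = w.
Proof. by rewrite /adjoin unlift_none. Qed.

Lemma adjoin_lift (q : nat) (T : Type) (w : T) (Lam : 'I_q -> T) (j : 'I_q) :
  adjoin w Lam (lift ord0 j) = Lam j.
Proof. by rewrite /adjoin liftK. Qed.

Lemma deval_substitute_xi1 (q : nat) (K E : diffField q.+1)
    (phi : diffExt K E) (w : E) (Lam : 'I_q -> E) (f : dpoly q.+1 K) :
  deval phi (adjoin w Lam) (substitute_xi1 f)
  = deval phi (fun i => w * adjoin 1 Lam i) f.
Proof.
rewrite deval_subst; apply: eq_deval => i.
case: (unliftP ord0 i) => [j|] ->.
  rewrite [in LHS]adjoin_lift [in RHS]adjoin_lift devalM.
  rewrite [X in X * _]deval_indet [X in _ * X]deval_indet.
  by rewrite adjoin_ord0 adjoin_lift.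
rewrite [in LHS]adjoin_ord0 [in RHS]adjoin_ord0.
by rewrite mulr1 deval_indet adjoin_ord0.
Qed.

(* p.+1 independent variables. *)
Theorem theorem2 (p k : nat) (K E : diffField p.+2) (phi : diffExt K E)
    (F : pde K) (D : seq (dpoly p.+1 K)) (D' C' : seq (dpoly p.+2 K))
    (le : rel (dvar p.+2 p.+2)) (Lam : 'I_p.+1 -> E) :
  pde_of_order k F ->
  nonclassical_determining_system phi F D ->
  classical_determining_system phi F D' ->
  ranking le ->
  xi1_highest le ->
  wu le D' C' ->
  (forall c, c \in C' -> dlinear c) ->
  (forall c, c \in C' -> initial le c != 0) ->
  (forall J, IS_product le C' J -> J != 0) ->
  dzero phi D Lam ->
  ~ (exists2 xi1' : E, xi1' != 0 &
       dzero phi [seq substitute_xi1 c | c <- C'] (adjoin xi1' Lam)) ->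
  nontrivial_nonclassical_symmetry phi F (adjoin 1 Lam).
Proof.
move=> _ nonclassicalD [_ classicalD'] _ _ wuC' _ _ _ DLam noZero.
split; first by apply/nonclassicalD.
(* A factor lambda making (1, Lam) classical is itself a forbidden xi_1'. *)
case=> X' /classicalD' D'X' [lambda lambda_neq0 X'E].
apply: noZero; exists lambda => // _ /mapP[c cC' ->].
rewrite deval_substitute_xi1 -(eq_deval phi c X'E).
exact: wu_zero wuC' D'X' c cC'.
Qed.
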